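(* Let $K_3+e$ denote the paw graph (a triangle together with one extra vertex adjacent to exactly one vertex of the triangle). Then $$D[K_3+e]=W[K_3+e]=W^*[K_3+e]=E[K_3+e]=3.$$
   Context: Graphs are finite, simple, undirected, loopless. First-order sentences about graphs use only adjacency $\sim$ and equality $=$. Write $F\sqsubset G$ if $G$ contains an induced copy of $F$. $D[F]$ (resp. $W[F]$) is the minimum quantifier depth (resp. minimum number of distinct variables) of a first-order sentence $\Phi$ such that for every graph $G$, $G\models\Phi$ iff $F\sqsubset G$. For non-isomorphic graphs $G,H$, $W(G,H)$ is the minimum number of distinct variables of a first-order sentence true on one and false on the other; $W^*[F]=\max\{W(G,H):F\sqsubset G,\ F\not\sqsubset H\}$. For $k\ge2$, $\mathrm{EA}_k$ says: for all disjoint vertex sets $X,Y$ with $|X\cup Y|<k$ there is $z\notin X\cup Y$ adjacent to all of $X$ and to none of $Y$; $\mathrm{EA}_1$ says the graph is non-empty. The extension index $E[F]$ is the minimum $k$ such that every graph satisfying $\mathrm{EA}_k$ contains an induced copy of $F$. *)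

(* Defs.v *)
From mathcomp Require Import all_boot.

Set Implicit Arguments.
Unset Strict Implicit.
Unset Printing Implicit Defensive.

(* The empty graph is allowed. *)
Record graph := Graph {
  vertex :> finType;
  adj : rel vertex;
  adj_sym : symmetric adj;
  adj_irr : irreflexive adj
}.

Definition induced_sub (F G : graph) : Prop :=
  exists f : F -> G, injective f /\ forall u v : F, adj (f u) (f v) = adj u v.

Inductive formula :=
| Adj of nat & nat
| Eq of nat & nat
| Not of formula
| And of formula & formula
| Or of formula & formula
| Ex of nat & formula
| All of nat & formula.

Fixpoint qdepth (p : formula) : nat :=
  match p with
  | Adj _ _ | Eq _ _ => 0
  | Not q => qdepth q
  | And q r | Or q r => maxn (qdepth q) (qdepth r)
  | Ex _ q | All _ q => (qdepth q).+1
  end.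

Fixpoint vars (p : formula) : seq nat :=
  match p with
  | Adj i j | Eq i j => [:: i; j]
  | Not q => vars q
  | And q r | Or q r => vars q ++ vars r
  | Ex i q | All i q => i :: vars q
  end.

Definition nvars (p : formula) : nat := size (undup (vars p)).

Fixpoint free_vars (p : formula) : seq nat :=
  match p with
  | Adj i j | Eq i j => [:: i; j]
  | Not q => free_vars q
  | And q r | Or q r => free_vars q ++ free_vars r
  | Ex i q | All i q => [seq j <- free_vars q | j != i]
  end.

Definition sentence (p : formula) : Prop := free_vars p = [::].

Definition update (G : graph) (s : nat -> option G) (i : nat) (x : G) :
  nat -> option G := fun j => if j == i then Some x else s j.

(* Assignments are partial because the empty graph has no total ones; the value
   chosen for an atom with an unassigned variable never affects a sentence. *)
Fixpoint sat (G : graph) (s : nat -> option G) (p : formula) : Prop :=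
  match p with
  | Adj i j => if (s i, s j) is (Some x, Some y) then adj x y else False
  | Eq i j => if (s i, s j) is (Some x, Some y) then x = y else False
  | Not q => ~ sat s q
  | And q r => sat s q /\ sat s r
  | Or q r => sat s q \/ sat s r
  | Ex i q => exists x : G, sat (update s i x) q
  | All i q => forall x : G, sat (update s i x) q
  end.

Definition models (G : graph) (p : formula) : Prop :=
  sat (fun _ => None : option G) p.

Definition is_min (P : nat -> Prop) (n : nat) : Prop :=
  P n /\ forall m, P m -> n <= m.

Definition is_max (P : nat -> Prop) (n : nat) : Prop :=
  P n /\ forall m, P m -> m <= n.

Definition expresses (F : graph) (p : formula) : Prop :=
  sentence p /\ forall G : graph, models G p <-> induced_sub F G.

(* D[F] = n *)
Definition D_eq (F : graph) (n : nat) : Prop :=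
  is_min (fun d => exists p, expresses F p /\ qdepth p = d) n.

(* W[F] = n *)
Definition W_eq (F : graph) (n : nat) : Prop :=
  is_min (fun w => exists p, expresses F p /\ nvars p = w) n.

Definition distinguishes (p : formula) (G H : graph) : Prop :=
  sentence p /\
  ((models G p /\ ~ models H p) \/ (~ models G p /\ models H p)).

(* W(G,H) = n; holds for no n when G and H are isomorphic *)
Definition Wpair_eq (G H : graph) (n : nat) : Prop :=
  is_min (fun w => exists p, distinguishes p G H /\ nvars p = w) n.

(* W^*[F] = n *)
Definition Wstar_eq (F : graph) (n : nat) : Prop :=
  is_max (fun w => exists G H : graph,
    [/\ induced_sub F G, ~ induced_sub F H & Wpair_eq G H w]) n.

(* For k = 1 this says that G is non-empty; k = 0 is excluded in E_eq. *)
Definition EA (k : nat) (G : graph) : Prop :=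
  forall X Y : {set G}, [disjoint X & Y] -> #|X :|: Y| < k ->
  exists z : G, [/\ z \notin X :|: Y,
                    (forall x, x \in X -> adj z x) &
                    (forall y, y \in Y -> ~~ adj z y)].

(* E[F] = n *)
Definition E_eq (F : graph) (n : nat) : Prop :=
  is_min (fun k => 0 < k /\ forall G : graph, EA k G -> induced_sub F G) n.

(* triangle 0, 1, 2 with vertex 3 attached to 0 *)
Definition paw_edges : seq (nat * nat) :=
  [:: (0, 1); (0, 2); (1, 2); (0, 3)].

Definition paw_adj (u v : 'I_4) : bool :=
  ((val u, val v) \in paw_edges) || ((val v, val u) \in paw_edges).

Lemma paw_adj_sym : symmetric paw_adj.
Proof. by move=> u v; rewrite /paw_adj orbC. Qed.

Lemma paw_adj_irr : irreflexive paw_adj.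
Proof. by case=> [[|[|[|[|m]]]] Hm]. Qed.

Definition paw : graph := Graph paw_adj_sym paw_adj_irr.

(* Main.v *)
Require Import Defs.
From mathcomp Require Import all_boot.

Set Implicit Arguments.
Unset Strict Implicit.
Unset Printing Implicit Defensive.

(** Upper bounds: a graph has an induced paw as soon as some vertex [x] of a
    triangle and some non-neighbour [y] of [x] have a common neighbour without
    being twins.  This is an instance of Olariu's theorem (components of
    paw-free graphs are triangle-free or complete multipartite, and
    non-adjacent vertices of a complete multipartite component are twins); it
    has quantifier depth 3, uses 3 variables, and is implied by [EA 3].

    Lower bounds: two graphs satisfying [EA k] agree on every sentence all of
    whose quantified subformulas have fewer than [k] free variables, in
    particular on sentences of depth at most [k] or with at most [k]
    variables.  The bull contains a paw, [2K_2] does not, and both satisfy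
    [EA 2]. *)

Lemma size_undup_subset (T : eqType) (s t : seq T) :
  {subset s <= t} -> size (undup s) <= size (undup t).
Proof.
move=> st; apply: uniq_leq_size; first exact: undup_uniq.
by move=> x; rewrite !mem_undup; apply: st.
Qed.

(** * Existential closure and bounded-variable equivalence *)

(** The bound counts the vertices already fixed when a quantifier picks a new one; fewer than [k] of
    them is exactly what [EA k] can handle. *)
Fixpoint narrow (k : nat) (p : formula) : bool :=
  match p with
  | Adj _ _ | Eq _ _ => true
  | Not q => narrow k q
  | And q r | Or q r => narrow k q && narrow k r
  | Ex i q | All i q =>
      (size (undup [seq j <- free_vars q | j != i]) < k) && narrow k q
  end.

Lemma free_vars_subset_vars (p : formula) : {subset free_vars p <= vars p}.
Proof.
elim: p => [? ?|? ?|//|p IHp q IHq|p IHp q IHq|i p IHp|i p IHp] j //=.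
- by rewrite !mem_cat => /orP[/IHp->|/IHq->]; rewrite ?orbT.
- by rewrite !mem_cat => /orP[/IHp->|/IHq->]; rewrite ?orbT.
- by rewrite mem_filter inE => /andP[_ /IHp->]; rewrite orbT.
- by rewrite mem_filter inE => /andP[_ /IHp->]; rewrite orbT.
Qed.

(** Strict because [i] occurs in the quantified formula but not among its free variables. *)
Lemma size_quantified_vars (i : nat) (q : formula) :
  size (undup [seq j <- free_vars q | j != i]) < size (undup (i :: vars q)).
Proof.
apply: (@leq_trans (size (i :: undup [seq j <- free_vars q | j != i]))) => //.
apply: uniq_leq_size.
  by rewrite /= undup_uniq mem_undup mem_filter eqxx.
move=> j; rewrite in_cons !mem_undup in_cons mem_filter.
by case/orP=> [->//|/andP[_ /free_vars_subset_vars->]]; rewrite orbT.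
Qed.

Lemma narrow_nvars (k : nat) (p : formula) : nvars p <= k -> narrow k p.
Proof.
rewrite /nvars; elim: p => //= [p IHp q IHq|p IHp q IHq|i p IHp|i p IHp] le_k.
- by apply/andP; split; [apply: IHp | apply: IHq]; apply: leq_trans le_k;
     apply: size_undup_subset => j; rewrite mem_cat => ->; rewrite ?orbT.
- by apply/andP; split; [apply: IHp | apply: IHq]; apply: leq_trans le_k;
     apply: size_undup_subset => j; rewrite mem_cat => ->; rewrite ?orbT.
- apply/andP; split; first exact: leq_trans (size_quantified_vars i p) le_k.
  by apply: IHp; apply: leq_trans le_k; apply: (@size_undup_subset _ _ (i :: _));
     move=> j; rewrite in_cons => ->; rewrite orbT.
- apply/andP; split; first exact: leq_trans (size_quantified_vars i p) le_k.
  by apply: IHp; apply: leq_trans le_k; apply: (@size_undup_subset _ _ (i :: _));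
     move=> j; rewrite in_cons => ->; rewrite orbT.
Qed.

Lemma size_undup_filter_neq (i : nat) (s : seq nat) :
  size (undup s) <= (size (undup [seq j <- s | j != i])).+1.
Proof.
apply: (@uniq_leq_size _ _ (i :: _)); first exact: undup_uniq.
move=> j; rewrite in_cons !mem_undup mem_filter => ->.
by rewrite andbT orbN.
Qed.

(** Passing under a quantifier lowers the depth by one and frees at most one variable, so the sum
    never grows on subformulas. *)
Lemma narrow_qdepth (k : nat) (p : formula) :
  size (undup (free_vars p)) + qdepth p <= k -> narrow k p.
Proof.
have cat_le (s t : seq nat) a b : size (undup (s ++ t)) + maxn a b <= k ->
    (size (undup s) + a <= k) /\ (size (undup t) + b <= k).
  move=> le_k; split; apply: leq_trans le_k; apply: leq_add;
    rewrite ?leq_maxl ?leq_maxr //; apply: size_undup_subset => j;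
    by rewrite mem_cat => ->; rewrite ?orbT.
have quant_le (i : nat) (s : seq nat) a : size (undup [seq j <- s | j != i]) + a.+1 <= k ->
    (size (undup [seq j <- s | j != i]) < k) /\ (size (undup s) + a <= k).
  rewrite addnS => le_k; split.
    by apply: leq_trans le_k; rewrite ltnS leq_addr.
  by apply: leq_trans le_k; rewrite -addSn leq_add2r size_undup_filter_neq.
elim: p => //= [p IHp q IHq|p IHp q IHq|i p IHp|i p IHp].
- by move=> /cat_le[/IHp-> /IHq->].
- by move=> /cat_le[/IHp-> /IHq->].
- by move=> /quant_le[-> /IHp->].
- by move=> /quant_le[-> /IHp->].
Qed.

Lemma EA_antimono (k l : nat) (G : graph) : k <= l -> EA l G -> EA k G.
Proof. by move=> le_kl EAl X Y dXY ltk; apply: EAl => //; apply: leq_trans le_kl. Qed.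

Lemma EA_nonempty (k : nat) (G : graph) : 0 < k -> EA k G -> exists z : G, True.
Proof.
move=> k_gt0 /(_ set0 set0); case; first by rewrite -setI_eq0 setI0.
  by rewrite setU0 cards0.
by move=> z _; exists z.
Qed.

Definition partial_iso (G H : graph) (V : seq nat) (f : nat -> G) (g : nat -> H) :=
  {in V &, forall i j, (f i == f j) = (g i == g j) /\ adj (f i) (f j) = adj (g i) (g j)}.

Lemma partial_iso_sym (G H : graph) (V : seq nat) (f : nat -> G) (g : nat -> H) :
  partial_iso V f g -> partial_iso V g f.
Proof. by move=> fg i j Vi Vj; case: (fg i j Vi Vj). Qed.

Definition set_at (T : Type) (f : nat -> T) (i : nat) (x : T) : nat -> T :=
  fun j => if j == i then x else f j.

(** One round of the back-and-forth game: [EA k H] supplies the reply to the choice of [x] in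
    [G]. *)
Lemma partial_iso_extend (k : nat) (G H : graph) (V : seq nat)
    (f : nat -> G) (g : nat -> H) (i : nat) (x : G) :
  EA k H -> size (undup [seq j <- V | j != i]) < k ->
  partial_iso [seq j <- V | j != i] f g ->
  exists y : H, partial_iso V (set_at f i x) (set_at g i y).
Proof.
move=> EAH; set U := [seq j <- V | j != i] => Uk fg.
suff [y yP] : exists y : H, {in U, forall j,
    (x == f j) = (y == g j) /\ adj x (f j) = adj y (g j)}.
  exists y => a b Va Vb; rewrite /set_at.
  have inU c : c \in V -> c != i -> c \in U by rewrite mem_filter => -> ->.
  have [ai|ai] := eqVneq a i; have [bi|bi] := eqVneq b i.
  - by rewrite !eqxx !adj_irr.
  - by apply: yP; apply: inU.
  - by rewrite ![_ == x]eq_sym ![_ == y]eq_sym ![adj _ x]adj_sym ![adj _ y]adj_sym;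
       apply: yP; apply: inU.
  - by apply: fg; apply: inU.
(* If [x] is already the value of some variable in [U], the reply is forced. *)
have [/hasP[j Uj /eqP->]|/hasPn xU] := boolP (has (fun j => x == f j) U).
  by exists (g j) => l Ul; apply: fg.
(* For a new [x], the reply must be adjacent to the images of its neighbours and to none of the
   images of its non-neighbours. *)
pose X := [set y in [seq g j | j <- U & adj x (f j)]].
pose Y := [set y in [seq g j | j <- U & ~~ adj x (f j)]].
have gX j : j \in U -> adj x (f j) -> g j \in X.
  by move=> Uj xj; rewrite inE map_f // mem_filter xj.
have gY j : j \in U -> ~~ adj x (f j) -> g j \in Y.
  by move=> Uj xj; rewrite inE map_f // mem_filter xj.
have dXY : [disjoint X & Y].
  rewrite -setI_eq0; apply/eqP/setP=> y; rewrite !inE; apply/negP=> /andP[].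
  move=> /mapP[a]; rewrite mem_filter => /andP[xa Ua] ->.
  move=> /mapP[b]; rewrite mem_filter => /andP[xb Ub] /eqP.
  by case: (fg a b Ua Ub) => <- _ /eqP fab; rewrite -fab xa in xb.
have XYk : #|X :|: Y| < k.
  apply: leq_ltn_trans Uk; rewrite -(size_map g) cardE.
  apply: uniq_leq_size => [|y]; first exact: enum_uniq.
  rewrite mem_enum !inE => /orP[] /mapP[a]; rewrite mem_filter => /andP[_ Ua] ->;
    by rewrite map_f ?mem_undup.
have [y [yXY yX yY]] := EAH X Y dXY XYk.
exists y => j Uj; have := xU j Uj => /negbTE->.
have [xj|xj] := boolP (adj x (f j)).
  rewrite yX ?gX //; split=> //; apply/esym/negbTE; apply: contra yXY => /eqP->.
  by rewrite inE gX.
rewrite (negbTE (yY _ (gY _ Uj xj))); split=> //; apply/esym/negbTE.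
by apply: contra yXY => /eqP->; rewrite inE orbC gY.
Qed.

Definition agrees (T : Type) (V : seq nat) (s : nat -> option T) (f : nat -> T) :=
  {in V, forall i, s i = Some (f i)}.

Lemma agrees_update (G : graph) (V : seq nat) (s : nat -> option G)
    (f : nat -> G) (i : nat) (x : G) :
  agrees [seq j <- V | j != i] s f -> agrees V (update s i x) (set_at f i x).
Proof.
move=> sf j Vj; rewrite /update /set_at; case: eqVneq => // ji.
by apply: sf; rewrite mem_filter ji.
Qed.

(** Induction on [p], with assignments and maps generalised; each quantifier is one application of
    [partial_iso_extend], in either direction. *)
Lemma EA_sat_iff (k : nat) (G H : graph) (p : formula) (s : nat -> option G)
    (t : nat -> option H) (f : nat -> G) (g : nat -> H) :
  EA k G -> EA k H -> narrow k p ->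
  agrees (free_vars p) s f -> agrees (free_vars p) t g ->
  partial_iso (free_vars p) f g -> sat s p <-> sat t p.
Proof.
move=> EAG EAH; elim: p s t f g
  => /= [i j|i j|p IHp|p IHp q IHq|p IHp q IHq|i p IHp|i p IHp] s t f g.
- move=> _ sf tg fg; have Ii : i \in [:: i; j] by rewrite !inE eqxx.
  have Ij : j \in [:: i; j] by rewrite !inE eqxx orbT.
  by rewrite !sf // !tg //; case: (fg i j) => // _ ->.
- move=> _ sf tg fg; have Ii : i \in [:: i; j] by rewrite !inE eqxx.
  have Ij : j \in [:: i; j] by rewrite !inE eqxx orbT.
  rewrite !sf // !tg //; case: (fg i j) => // eq_fg _.
  by split=> /eqP; [rewrite eq_fg | rewrite -eq_fg] => /eqP.
- by move=> wp sf tg fg; have := IHp s t f g wp sf tg fg; tauto.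
- move=> /andP[wp wq] sf tg fg.
  have Sp : {subset free_vars p <= free_vars p ++ free_vars q}.
    by move=> j; rewrite mem_cat => ->.
  have Sq : {subset free_vars q <= free_vars p ++ free_vars q}.
    by move=> j; rewrite mem_cat orbC => ->.
  have := IHp s t f g wp (sub_in1 Sp sf) (sub_in1 Sp tg) (sub_in2 Sp fg).
  have := IHq s t f g wq (sub_in1 Sq sf) (sub_in1 Sq tg) (sub_in2 Sq fg).
  by tauto.
- move=> /andP[wp wq] sf tg fg.
  have Sp : {subset free_vars p <= free_vars p ++ free_vars q}.
    by move=> j; rewrite mem_cat => ->.
  have Sq : {subset free_vars q <= free_vars p ++ free_vars q}.
    by move=> j; rewrite mem_cat orbC => ->.
  have := IHp s t f g wp (sub_in1 Sp sf) (sub_in1 Sp tg) (sub_in2 Sp fg).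
  have := IHq s t f g wq (sub_in1 Sq sf) (sub_in1 Sq tg) (sub_in2 Sq fg).
  by tauto.
- move=> /andP[ltk wp] sf tg fg; split=> [[x]|[y]].
    have [y xy] := partial_iso_extend x EAH ltk fg.
    by move/(IHp _ _ _ _ wp (agrees_update x sf) (agrees_update y tg) xy); exists y.
  have [x yx] := partial_iso_extend y EAG ltk (partial_iso_sym fg).
  move/(IHp _ _ _ _ wp (agrees_update x sf) (agrees_update y tg)
          (partial_iso_sym yx)).
  by exists x.
- move=> /andP[ltk wp] sf tg fg; split=> [sx y|ty x].
    have [x yx] := partial_iso_extend y EAG ltk (partial_iso_sym fg).
    by apply/(IHp _ _ _ _ wp (agrees_update x sf) (agrees_update y tg)
          (partial_iso_sym yx)).
  have [y xy] := partial_iso_extend x EAH ltk fg.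
  by apply/(IHp _ _ _ _ wp (agrees_update x sf) (agrees_update y tg) xy).
Qed.

Lemma EA_models_iff (k : nat) (G H : graph) (p : formula) :
  0 < k -> EA k G -> EA k H -> sentence p -> narrow k p ->
  models G p <-> models H p.
Proof.
move=> k_gt0 EAG EAH closed_p wp.
have [x _] := EA_nonempty k_gt0 EAG; have [y _] := EA_nonempty k_gt0 EAH.
(* A sentence has no free variables, so constant maps form a vacuous partial isomorphism. *)
by apply: (EA_sat_iff (f := fun=> x) (g := fun=> y) EAG EAH wp);
  move=> i; rewrite closed_p.
Qed.

(** Here [X :|: Y] has at most one vertex; [z] serves when it is empty. *)
Lemma EA2_intro (G : graph) (z : G) :
  (forall v : G, exists w, adj w v) ->
  (forall v : G, exists2 w, w != v & ~~ adj w v) -> EA 2 G.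
Proof.
move=> nbr non X Y dXY; rewrite ltnS => leXY.
have XY1 u v : u \in X :|: Y -> v \in X :|: Y -> u = v.
  by move=> uXY vXY; apply: (card_le1_eqP leXY).
have [/eqP|[v vXY]] := set_0Vmem (X :|: Y).
  rewrite setU_eq0 => /andP[/eqP-> /eqP->].
  by exists z; split=> [|x|y]; rewrite !inE.
have [vX|vX] := boolP (v \in X).
  have vY : v \notin Y by rewrite (disjointFr dXY vX).
  have [w wv] := nbr v; exists w; split=> [|x xX|y yY].
  - by apply/negP=> /XY1/(_ vXY) wE; rewrite wE adj_irr in wv.
  - by rewrite (XY1 x v) // inE xX.
  - by rewrite -(XY1 y v) ?yY // ?inE ?yY ?orbT // in vY.
have [w wv nwv] := non v; exists w; split=> [|x xX|y yY].
- by apply/negP=> /XY1/(_ vXY) /eqP; rewrite (negbTE wv).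
- by rewrite -(XY1 x v) ?xX // ?inE ?xX // in vX.
- by rewrite (XY1 y v) // inE yY orbT.
Qed.

(** * The defining sentence *)

Lemma induced_paw_intro (G : graph) (a b c d : G) :
  adj a b -> adj a c -> adj b c -> adj a d -> ~~ adj b d -> ~~ adj c d ->
  induced_sub paw G.
Proof.
move=> ab ac bc ad /negbTE bd /negbTE cd.
pose f (u : paw) := nth a [:: a; b; c; d] (val u).
have f_adj u v : adj (f u) (f v) = adj u v.
  by case: u v => [[|[|[|[|u]]]] ?] [[|[|[|[|v]]]] ?] //=; rewrite /f /=
    ?adj_irr ?ab ?ac ?bc ?ad ?bd ?cd // adj_sym ?ab ?ac ?bc ?ad ?bd ?cd.
(* Injectivity comes for free: distinct vertices of the paw differ in their adjacency to the
   triangle 0, 1, 2. *)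
exists f; split=> // u v fuv.
have {fuv} uv w : adj u w = adj v w by rewrite -!f_adj fuv.
have := (uv (inord 0), uv (inord 1), uv (inord 2)).
rewrite /= /paw_adj /= !inordK //.
by case: u v {uv} => [[|[|[|[|u]]]] ?] [[|[|[|[|v]]]] ?] //= [[? ?] ?];
  apply: val_inj.
Qed.

Definition has_paw_witness (G : graph) : Prop :=
  exists x : G,
    (exists y z : G, [/\ adj x y, adj x z & adj y z]) /\
    (exists y : G, [/\ x <> y, ~~ adj x y,
       exists z : G, adj x z /\ adj y z & exists z : G, adj x z /\ ~~ adj y z]).

(* Without a paw on [x c e y], [e] is adjacent to [y]; without a paw on
   [x c e d], [d] is adjacent to [c] or [e], which then spans a paw with
   [x], [d] and [y]. *)
Lemma paw_witness_triangle (G : graph) (x y c d e : G) :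
  adj x c -> adj x e -> adj c e -> ~~ adj x y -> adj y c ->
  adj x d -> ~~ adj y d -> induced_sub paw G.
Proof.
move=> xc xe ce xy yc xd yd.
have cx : adj c x by rewrite adj_sym.
have ex : adj e x by rewrite adj_sym.
have ec : adj e c by rewrite adj_sym.
have cy : adj c y by rewrite adj_sym.
have dy : ~~ adj d y by rewrite adj_sym.
have [ey|ey] := boolP (adj e y); last exact: (induced_paw_intro cx ce xe cy xy ey).
have [cd|cd] := boolP (adj c d); first exact: (induced_paw_intro cx cd xd cy xy dy).
have [ed|ed] := boolP (adj e d); first exact: (induced_paw_intro ex ed xd ey xy dy).
exact: (induced_paw_intro xc xe ce xd cd ed).
Qed.

Lemma induced_pawP (G : graph) : induced_sub paw G <-> has_paw_witness G.
Proof.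
split.
  (* Take [x] to be a triangle vertex of degree two and [y] the pendant vertex; 0 is their common
     neighbour and 2 is adjacent to [x] only. *)
  case=> f [f_inj f_adj]; exists (f (inord 1)); split.
    by exists (f (inord 0)), (f (inord 2)); rewrite !f_adj /= /paw_adj /= !inordK.
  exists (f (inord 3)); split.
  - by move=> /f_inj /(congr1 val) /=; rewrite !inordK.
  - by rewrite f_adj /= /paw_adj /= !inordK.
  - by exists (f (inord 0)); rewrite !f_adj /= /paw_adj /= !inordK.
  - by exists (f (inord 2)); rewrite !f_adj /= /paw_adj /= !inordK.
case=> x [[a [b [xa xb ab]]] [y [_ xy [c [xc yc]] [d [xd yd]]]]].
(* If [c] is adjacent to [a] or [b], it lies in a triangle with [x]; otherwise it is pendant at [x]
   on the triangle [x], [a], [b]. *)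
have [ca|ca] := boolP (adj c a); first exact: (paw_witness_triangle xc xa ca xy yc xd yd).
have [cb|cb] := boolP (adj c b); first exact: (paw_witness_triangle xc xb cb xy yc xd yd).
by apply: (induced_paw_intro xa xb ab xc); rewrite adj_sym.
Qed.

(** Variables 1 and 2 are rebound in each conjunct, which keeps the number of variables at three. *)
Definition paw_sentence : formula :=
  Ex 0 (And
    (Ex 1 (Ex 2 (And (Adj 0 1) (And (Adj 0 2) (Adj 1 2)))))
    (Ex 1 (And (Not (Eq 0 1)) (And (Not (Adj 0 1)) (And
       (Ex 2 (And (Adj 0 2) (Adj 1 2)))
       (Ex 2 (And (Adj 0 2) (Not (Adj 1 2))))))))).

Lemma paw_sentence_expresses : expresses paw paw_sentence.
Proof.
split=> // G; split=> [|/induced_pawP].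
  move=> h; apply/induced_pawP; case: h => x /= [[a [b [xa [xb ab]]]] [y [nxy [/negP xy [[c [xc yc]] [d [xd /negP yd]]]]]]].
  by exists x; split; [exists a, b | exists y; split=> //; [exists c | exists d]].
case=> x [[a [b [xa xb ab]]] [y [nxy /negP xy [c [xc yc]] [d [xd /negP yd]]]]].
exists x => /=; split; first by exists a, b.
by exists y; do 3![split=> //]; [exists c | exists d].
Qed.

Lemma EA3_induced_paw (G : graph) : EA 3 G -> induced_sub paw G.
Proof.
move=> EAG; apply/induced_pawP.
(* The case [u = v] is allowed, and gives a neighbour of a single vertex. *)
have ext2 u v : exists z : G, adj z u /\ adj z v.
  have [||z [_ zX _]] := EAG [set u; v] set0.
  - by rewrite -setI_eq0 setI0.
  - by rewrite setU0 cards2; case: (_ == _).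
  - by exists z; rewrite !zX // !inE eqxx ?orbT.
have [x _] := @EA_nonempty 3 G isT EAG.
exists x; split.
  have [y [yx _]] := ext2 x x; have [z [zx zy]] := ext2 x y.
  by exists y, z; split; rewrite adj_sym.
have [||y [yx _ yY]] := EAG set0 [set x].
- by rewrite -setI_eq0 set0I.
- by rewrite set0U cards1.
have {yx} xy : x <> y by move=> xy; rewrite !inE xy eqxx in yx.
exists y; split=> //.
- by rewrite adj_sym yY // inE.
- by have [z [zx zy]] := ext2 x y; exists z; split; rewrite adj_sym.
- have [||z [_ zX zY]] := EAG [set x] [set y].
  + by rewrite disjoints1 inE; apply/eqP.
  + by rewrite cards2; case: (_ == _).
  + by exists z; rewrite adj_sym zX ?inE // adj_sym zY ?inE.
Qed.

(** * Two graphs separated by the paw *)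

(** The first coordinate selects the edge of $2K_2$, the second its endpoint. *)
Definition two_edges_adj (u v : bool * bool) : bool :=
  (u.1 == v.1) && (u.2 != v.2).

Lemma two_edges_adj_sym : symmetric two_edges_adj.
Proof. by move=> [[] []] [[] []]. Qed.

Lemma two_edges_adj_irr : irreflexive two_edges_adj.
Proof. by move=> [[] []]. Qed.

Definition two_edges : graph := Graph two_edges_adj_sym two_edges_adj_irr.

Lemma two_edges_EA2 : EA 2 two_edges.
Proof.
apply: (@EA2_intro two_edges (true, true)) => -[a b].
  by exists (a, ~~ b); case: a b => -[].
by exists (~~ a, b); case: a b => -[].
Qed.

Lemma two_edges_paw_free : ~ induced_sub paw two_edges.
Proof.
(* There is not even a triangle: its vertices would share the first coordinate and differ pairwise
   in a boolean. *)
move=> /induced_pawP[x [[y [z [xy xz yz]]] _]].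
by case: x y z xy xz yz => [[] []] [[] []] [[] []].
Qed.

(** The paw with a second pendant vertex 4, attached to the triangle vertex 1. *)
Definition bull_adj (u v : 'I_5) : bool :=
  ((val u, val v) \in (1, 4) :: paw_edges)
  || ((val v, val u) \in (1, 4) :: paw_edges).

Lemma bull_adj_sym : symmetric bull_adj.
Proof. by move=> u v; rewrite /bull_adj orbC. Qed.

Lemma bull_adj_irr : irreflexive bull_adj.
Proof. by case=> [[|[|[|[|[|m]]]]] Hm]. Qed.

Definition bull : graph := Graph bull_adj_sym bull_adj_irr.

Lemma bull_EA2 : EA 2 bull.
Proof.
apply: (@EA2_intro bull ord0) => -[v v5].
  (* Entry [v] of this list is a neighbour of [v]; the list used below gives a non-neighbour. *)
  exists (inord (nth 0 [:: 1; 0; 0; 0; 1] v)); rewrite /= /bull_adj.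
  by case: v v5 => [|[|[|[|[|v]]]]] //= _; rewrite inordK.
exists (inord (nth 0 [:: 4; 3; 3; 4; 3] v)).
  by rewrite -val_eqE /=; case: v v5 => [|[|[|[|[|v]]]]] //= _; rewrite inordK.
by rewrite /= /bull_adj; case: v v5 => [|[|[|[|[|v]]]]] //= _; rewrite inordK.
Qed.

Lemma bull_induced_paw : induced_sub paw bull.
Proof.
by apply: (@induced_paw_intro bull (inord 0) (inord 1) (inord 2) (inord 3));
  rewrite /= /bull_adj /= !inordK.
Qed.

Lemma bull_two_edges_equiv (p : formula) :
  sentence p -> narrow 2 p -> models bull p <-> models two_edges p.
Proof. exact: EA_models_iff bull_EA2 two_edges_EA2. Qed.

Lemma paw_not_narrow (p : formula) : expresses paw p -> ~~ narrow 2 p.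
Proof.
case=> closed_p p_paw; apply/negP=> /(bull_two_edges_equiv closed_p).
case=> models_imp _; apply: two_edges_paw_free; apply/p_paw/models_imp.
by apply/p_paw; apply: bull_induced_paw.
Qed.

(** * The values of the four parameters *)

Lemma paw_sentence_distinguishes (G H : graph) :
  induced_sub paw G -> ~ induced_sub paw H -> distinguishes paw_sentence G H.
Proof.
move=> pG pH; case: paw_sentence_expresses => closed_p p_paw.
by split=> //; left; split; [apply/p_paw | move/p_paw].
Qed.

Theorem theorem4p2 :
  [/\ D_eq paw 3, W_eq paw 3, Wstar_eq paw 3 & E_eq paw 3].
Proof.
split; split.
- by exists paw_sentence; split=> //; apply: paw_sentence_expresses.
- move=> _ [p [p_paw <-]]; rewrite ltnNge; apply: contra (paw_not_narrow p_paw).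
  (* With no free variables, the sum in [narrow_qdepth] is just the depth. *)
  by move=> le2; apply: narrow_qdepth; case: p_paw => ->.
- by exists paw_sentence; split=> //; apply: paw_sentence_expresses.
- move=> _ [p [p_paw <-]]; rewrite ltnNge; apply: contra (paw_not_narrow p_paw).
  exact: narrow_nvars.
- exists bull, two_edges; split.
  + exact: bull_induced_paw.
  + exact: two_edges_paw_free.
  split.
    exists paw_sentence; split=> //; apply: paw_sentence_distinguishes.
      exact: bull_induced_paw.
    exact: two_edges_paw_free.
  move=> _ [p [[closed_p dist] <-]]; rewrite ltnNge; apply/negP=> /narrow_nvars.
  by move/(bull_two_edges_equiv closed_p); tauto.
(* The same three-variable sentence separates every admissible pair, so it bounds the maximum. *)
- move=> m [G [H [pG pH [_ minm]]]]; apply: minm.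
  by exists paw_sentence; split=> //; apply: paw_sentence_distinguishes.
- by split=> //; apply: EA3_induced_paw.
(* For [m] at most 2, the paw-free graph $2K_2$ satisfies [EA m]. *)
- move=> m [_ m_paw]; rewrite ltnNge; apply/negP=> le2.
  exact: two_edges_paw_free (m_paw _ (EA_antimono le2 two_edges_EA2)).
Qed.
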